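(* Let $\lambda>0$, and let $(S_k,U_k,P_k)$ with $U_k\ge 0$ be a critical point of the system $$S'=-\tfrac{1}{3\sqrt3}-\tfrac23S+\tfrac1{\sqrt3}S^2+\tfrac1{\sqrt3}U^2+\tfrac1{2\sqrt3}P^2+2S^3-SU^2+SP^2,$$ $$U'=U\bigl(\tfrac13-\tfrac\lambda2P+2S^2-U^2+P^2\bigr),\qquad P'=-\tfrac23P+\lambda U^2+2S^2P-U^2P+P^3 .$$ Put $A_k=-\frac13-2S_k^2+U_k^2-P_k^2$. Then for $t>0$ $$\theta=-\frac{1}{A_kt},\quad \sigma=-\frac{S_k}{A_kt},\quad \psi=-\frac{P_k}{A_kt},\quad V=z^2=\frac{U_k^2}{A_k^2t^2}\quad\Bigl(z=-\frac{U_k}{A_kt}\Bigr)$$ is an exact solution of $$\dot\theta=-\tfrac13\theta^2-2\sigma^2+z^2-\psi^2,\quad \dot\sigma=-\tfrac{1}{3\sqrt3}\theta^2-\theta\sigma+\tfrac{1}{\sqrt3}\sigma^2+\tfrac{1}{\sqrt3}\bigl(z^2+\tfrac12\psi^2\bigr),\quad \dot z=-\tfrac\lambda2\psi z,\quad \dot\psi=-\theta\psi+\lambda z^2 .$$ Explicitly, the following are exact solutions of this system for $t>0$ (with $V=z^2$, $z\ge0$): (1) $\theta=\frac2t$, $\sigma=-\frac1{\sqrt3\,t}$, $\psi=0$, $V=0$ (from $S=-\frac{1}{2\sqrt3},U=P=0$); (2) for $\lambda\le\sqrt6$: $\theta=\frac{6}{\lambda^2t}$, $\sigma=0$, $\psi=\frac2{\lambda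 t}$, $V=\frac{2(6-\lambda^2)}{\lambda^4t^2}$ (from $S=0$, $U=\sqrt{\frac{6-\lambda^2}{18}}$, $P=\frac\lambda3$); (3) $\theta=\frac{2(\lambda^2+1)}{\lambda^2t}$, $\sigma=\frac{2-\lambda^2}{\sqrt3\,\lambda^2t}$, $\psi=\frac2{\lambda t}$, $V=\frac{2(\lambda^2+2)}{\lambda^4t^2}$ (from $S=\frac1{2\sqrt3}\frac{2-\lambda^2}{\lambda^2+1}$, $U=\frac{\sqrt{\lambda^2+2}}{\sqrt2(\lambda^2+1)}$, $P=\frac\lambda{\lambda^2+1}$); (4) for all real $\sigma_0,\psi_0$ with $\frac23-2\sigma_0^2-\psi_0^2=0$: $\theta=\frac1t$, $\sigma=\frac{\sigma_0}t$, $\psi=\frac{\psi_0}t$, $V=0$ (from $S=\sigma_0$, $U=0$, $P=\psi_0$).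
   Context: The second system is the Einstein–Klein–Gordon system (units $8\pi G=1$) for a scalar field $\varphi$, $\psi=\dot\varphi$, with exponential potential $V=V_0e^{-\lambda\varphi}$, written in the variables $(\theta,\sigma,z=\sqrt V,\psi)$, where $\theta$ is the expansion and $\sigma$ the shear of a Bianchi I, Bianchi III or Kantowski–Sachs universe; solutions with $z=0$ are admitted as solutions of the system in these variables. The first system is obtained from it by $\sigma=S\theta$, $z=U\theta$, $\psi=P\theta$, $'=\frac{d}{d\tau}=\frac1\theta\frac d{dt}$. *)

(* Defs.v *)
From Stdlib Require Import Reals Lra.
From Coquelicot Require Import Coquelicot.
Open Scope R_scope.

Definition field_S (S U P : R) : R :=
  - (1 / (3 * sqrt 3)) - 2 / 3 * S + 1 / sqrt 3 * S ^ 2 + 1 / sqrt 3 * U ^ 2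
  + 1 / (2 * sqrt 3) * P ^ 2 + 2 * S ^ 3 - S * U ^ 2 + S * P ^ 2.

Definition field_U (lambda S U P : R) : R :=
  U * (1 / 3 - lambda / 2 * P + 2 * S ^ 2 - U ^ 2 + P ^ 2).

Definition field_P (lambda S U P : R) : R :=
  - (2 / 3) * P + lambda * U ^ 2 + 2 * S ^ 2 * P - U ^ 2 * P + P ^ 3.

Definition critical_point (lambda S U P : R) : Prop :=
  field_S S U P = 0 /\ field_U lambda S U P = 0 /\ field_P lambda S U P = 0.

Definition A_coef (S U P : R) : R := - (1 / 3) - 2 * S ^ 2 + U ^ 2 - P ^ 2.

Definition EKG_solution (lambda : R) (theta sigma z psi : R -> R) : Prop :=
  forall t : R, 0 < t ->
    is_derive theta t
      (- (1 / 3) * theta t ^ 2 - 2 * sigma t ^ 2 + z t ^ 2 - psi t ^ 2) /\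
    is_derive sigma t
      (- (1 / (3 * sqrt 3)) * theta t ^ 2 - theta t * sigma t
       + 1 / sqrt 3 * sigma t ^ 2
       + 1 / sqrt 3 * (z t ^ 2 + 1 / 2 * psi t ^ 2)) /\
    is_derive z t (- (lambda / 2) * psi t * z t) /\
    is_derive psi t (- theta t * psi t + lambda * z t ^ 2).

(** A solution given through the potential V instead of z; the conditions
    [0 <= z] and [V = z^2] say that z = sqrt V, and force [0 <= V]. *)
Definition EKG_solution_V (lambda : R) (theta sigma psi V : R -> R) : Prop :=
  exists z : R -> R,
    (forall t : R, 0 < t -> 0 <= z t /\ V t = z t ^ 2) /\
    EKG_solution lambda theta sigma z psi.

(** (theta, sigma, psi, V) is the self-similar solution attached to the
    critical point (S, U, P). [A_coef S U P <> 0] is required because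
    division by zero is total. *)
Definition from_critical_point (lambda S U P : R)
    (theta sigma psi V : R -> R) : Prop :=
  critical_point lambda S U P /\ 0 <= U /\ A_coef S U P <> 0 /\
  forall t : R, 0 < t ->
    theta t = - (1 / (A_coef S U P * t)) /\
    sigma t = - (S / (A_coef S U P * t)) /\
    psi t = - (P / (A_coef S U P * t)) /\
    V t = U ^ 2 / (A_coef S U P ^ 2 * t ^ 2).

(* Main.v *)
Require Import Defs.
From Stdlib Require Import Reals Lra.
From Coquelicot Require Import Coquelicot.
Open Scope R_scope.

(** With [A = A_coef S U P], the ansatz [theta = - 1 / (A t)] solves
    [theta' = A theta^2], and each remaining equation for
    [(sigma, z, psi) = theta (S, U, P)] becomes the vanishing of the
    corresponding component of the vector field.  The ansatz makes sense, with
    [z >= 0], because [A < 0] at every critical point with [U >= 0]. *)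

(* If [0 <= A] then [U > 0], so the [U]-equation gives [lambda P / 2 = - A <= 0],
   whereas the [P]-equation gives [P (1 + A) = lambda U^2 > 0]. *)
Lemma A_coef_neg (lambda S U P : R) :
  0 < lambda -> 0 <= U -> critical_point lambda S U P -> A_coef S U P < 0.
Proof.
  intros Hl HU (_ & HfU & HfP).
  destruct (Rlt_or_le (A_coef S U P) 0) as [HA | HA]; [exact HA | exfalso].
  assert (HU2 : 0 < U ^ 2) by (unfold A_coef in HA; nra).
  assert (HU0 : U <> 0) by nra.
  assert (EU : lambda * P = - 2 * A_coef S U P).
  { apply (Rmult_eq_reg_l U); [| exact HU0].
    unfold field_U in HfU; unfold A_coef; nra. }
  assert (EP : P * (1 + A_coef S U P) = lambda * U ^ 2)
    by (unfold field_P in HfP; unfold A_coef; nra).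
  assert (HP : P <= 0) by nra.
  assert (0 < lambda * U ^ 2) by (apply Rmult_lt_0_compat; assumption).
  nra.
Qed.

(** The derivative is [c / (A * t ^ 2)]. It is written over [(A * t) ^ 2], the denominator shared by
    all products of two ansatz functions, so that [d] becomes the quadratic right-hand side
    evaluated at [(1, S, U, P)]. *)
Lemma is_derive_self_similar (A c d t : R) :
  A <> 0 -> t <> 0 -> c * A = d ->
  is_derive (fun t : R => - (c / (A * t))) t (d / (A * t) ^ 2).
Proof.
  intros HA Ht <-.
  auto_derive; [auto | field; auto].
Qed.

Lemma self_similar_solution (lambda S U P : R) :
  A_coef S U P <> 0 -> critical_point lambda S U P ->
  EKG_solution lambda
    (fun t => - (1 / (A_coef S U P * t))) (fun t => - (S / (A_coef S U P * t)))
    (fun t => - (U / (A_coef S U P * t))) (fun t => - (P / (A_coef S U P * t))).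
Proof.
  intros HA (HS & HU & HP) t Ht.
  assert (Ht0 : t <> 0) by lra.
  assert (H3 : sqrt 3 <> 0) by (apply Rgt_not_eq, sqrt_lt_R0; lra).
  (* In each of [ES], [EU] and [EP], left side minus right side is the negative of the matching
     field component, which vanishes at a critical point. *)
  assert (ES : S * A_coef S U P = - (1 / (3 * sqrt 3)) - S + 1 / sqrt 3 * S ^ 2
                 + 1 / sqrt 3 * (U ^ 2 + 1 / 2 * P ^ 2)).
  { apply Rminus_diag_uniq; rewrite <- Ropp_0, <- HS.
    unfold field_S, A_coef; field; exact H3. }
  assert (EU : U * A_coef S U P = - (lambda / 2) * P * U).
  { apply Rminus_diag_uniq; rewrite <- Ropp_0, <- HU.
    unfold field_U, A_coef; field. }
  assert (EP : P * A_coef S U P = - P + lambda * U ^ 2).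
  { apply Rminus_diag_uniq; rewrite <- Ropp_0, <- HP.
    unfold field_P, A_coef; field. }
  assert (Et : 1 * A_coef S U P = - (1 / 3) - 2 * S ^ 2 + U ^ 2 - P ^ 2)
    by (unfold A_coef; ring).
  (* From here [A] is an arbitrary nonzero number: its definition has been used up in the identities
     [c * A = d], whose right sides are free of [A]. *)
  revert HA ES EU EP Et; generalize (A_coef S U P); intros A HA ES EU EP Et.
  split; [| split; [| split]].
  - evar_last; [exact (is_derive_self_similar A _ _ t HA Ht0 Et) | field; auto].
  - evar_last; [exact (is_derive_self_similar A _ _ t HA Ht0 ES) | field; auto].
  - evar_last; [exact (is_derive_self_similar A _ _ t HA Ht0 EU) | field; auto].
  - evar_last; [exact (is_derive_self_similar A _ _ t HA Ht0 EP) | field; auto].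
Qed.

(** The half-line of positive reals is open, so it is a neighbourhood of [t], and a derivative
    depends only on values near the point. *)
Lemma is_derive_eq_on_pos (f g : R -> R) (t d : R) :
  (forall s : R, 0 < s -> f s = g s) -> 0 < t ->
  is_derive g t d -> is_derive f t d.
Proof.
  intros Hfg Ht; apply is_derive_ext_loc.
  apply (filter_imp (fun s => 0 < s)).
  - intros s Hs; symmetry; auto.
  - exact (open_gt 0 t Ht).
Qed.

Lemma EKG_solution_ext (lambda : R)
    (theta sigma z psi theta' sigma' z' psi' : R -> R) :
  (forall t : R, 0 < t -> theta t = theta' t) ->
  (forall t : R, 0 < t -> sigma t = sigma' t) ->
  (forall t : R, 0 < t -> z t = z' t) ->
  (forall t : R, 0 < t -> psi t = psi' t) ->
  EKG_solution lambda theta' sigma' z' psi' ->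
  EKG_solution lambda theta sigma z psi.
Proof.
  intros Htheta Hsigma Hz Hpsi H t Ht.
  rewrite Htheta, Hsigma, Hz, Hpsi by exact Ht.
  destruct (H t Ht) as (H1 & H2 & H3 & H4).
  split; [| split; [| split]]; eapply is_derive_eq_on_pos; eauto.
Qed.

(** The sign of [A] makes [- (U / (A * t))] the nonnegative root of the potential. *)
Lemma self_similar_potential (A U t : R) :
  A < 0 -> 0 <= U -> 0 < t ->
  0 <= - (U / (A * t)) /\ U ^ 2 / (A ^ 2 * t ^ 2) = (- (U / (A * t))) ^ 2.
Proof.
  intros HA HU Ht; split.
  - replace (- (U / (A * t))) with (U / (- A * t)) by (field; lra).
    apply Rcomplements.Rdiv_le_0_compat; [exact HU | nra].
  - field; lra.
Qed.

Lemma from_critical_point_solution (lambda S U P : R)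
    (theta sigma psi V : R -> R) :
  0 < lambda -> from_critical_point lambda S U P theta sigma psi V ->
  EKG_solution_V lambda theta sigma psi V.
Proof.
  intros Hl (Hc & HU & HA & H).
  exists (fun t => - (U / (A_coef S U P * t))); split.
  - intros t Ht; destruct (H t Ht) as (_ & _ & _ & ->).
    apply self_similar_potential; auto.
    exact (A_coef_neg lambda S U P Hl HU Hc).
  (* The given functions are known to agree with the ansatz only for positive times. *)
  - refine (EKG_solution_ext _ _ _ _ _ _ _ _ _ _ _ _ _
              (self_similar_solution lambda S U P HA Hc));
      intros t Ht; destruct (H t Ht) as (? & ? & ? & ?); auto.
Qed.

(** For [U = P = 0] the field component [field_S] is [(S + 1 / (2 * sqrt 3)) * (2 * S ^ 2 - 2 / 3)];
    this point is the zero of the linear factor. *)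
Lemma from_critical_point_shear_only (lambda : R) :
  from_critical_point lambda (- (1 / (2 * sqrt 3))) 0 0
    (fun t => 2 / t) (fun t => - (1 / (sqrt 3 * t))) (fun _ => 0) (fun _ => 0).
Proof.
  assert (H3 : sqrt 3 ^ 2 = 3) by (apply pow2_sqrt; lra).
  assert (H0 : sqrt 3 <> 0) by (apply Rgt_not_eq, sqrt_lt_R0; lra).
  assert (EA : A_coef (- (1 / (2 * sqrt 3))) 0 0 = - (1 / 2)).
  { unfold A_coef.
    (* [field] treats [sqrt 3] as an atom, so its square is exposed for [H3] to eliminate. *)
    replace ((- (1 / (2 * sqrt 3))) ^ 2) with (1 / (4 * sqrt 3 ^ 2))
      by (field; exact H0).
    rewrite H3; field. }
  unfold from_critical_point; rewrite EA.
  repeat split; try lra; try (field; lra).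
  - unfold field_S.
    replace ((- (1 / (2 * sqrt 3))) ^ 3)
      with (- (1 / (8 * sqrt 3 ^ 2 * sqrt 3))) by (field; exact H0).
    replace ((- (1 / (2 * sqrt 3))) ^ 2) with (1 / (4 * sqrt 3 ^ 2))
      by (field; exact H0).
    rewrite H3; field; exact H0.
  - unfold field_U; ring.
  - unfold field_P; ring.
Qed.

(** For [S = 0] the [S]-equation reads [U ^ 2 + P ^ 2 / 2 = 1 / 3]. Inserted into
    [A = - lambda * P / 2], the [U]-equation for nonzero [U], it leaves [3 * P ^ 2 = lambda * P],
    whence [P = lambda / 3]. *)
Lemma from_critical_point_isotropic (lambda : R) :
  0 < lambda -> lambda <= sqrt 6 ->
  from_critical_point lambda
    0 (sqrt ((6 - lambda ^ 2) / 18)) (lambda / 3)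
    (fun t => 6 / (lambda ^ 2 * t)) (fun _ => 0) (fun t => 2 / (lambda * t))
    (fun t => 2 * (6 - lambda ^ 2) / (lambda ^ 4 * t ^ 2)).
Proof.
  intros Hl Hl6.
  assert (H0 : sqrt 3 <> 0) by (apply Rgt_not_eq, sqrt_lt_R0; lra).
  (* This makes the radicand of [U] nonnegative; on negative arguments [sqrt] returns 0 and [HU2]
     would fail. *)
  assert (H6 : lambda ^ 2 <= 6).
  { rewrite <- (pow2_sqrt 6) by lra; apply pow_incr; lra. }
  pose proof (sqrt_pos ((6 - lambda ^ 2) / 18)) as HU.
  assert (HU2 : sqrt ((6 - lambda ^ 2) / 18) ^ 2 = (6 - lambda ^ 2) / 18)
    by (apply pow2_sqrt; lra).
  revert HU HU2; generalize (sqrt ((6 - lambda ^ 2) / 18)); intros U HU HU2.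
  assert (EA : A_coef 0 U (lambda / 3) = - (lambda ^ 2 / 6))
    by (unfold A_coef; rewrite HU2; field).
  unfold from_critical_point; rewrite EA.
  repeat split; try rewrite HU2; try exact HU; try (field; lra).
  - unfold field_S; rewrite HU2; field; exact H0.
  - unfold field_U; rewrite HU2; field.
  - unfold field_P; rewrite HU2; field.
  - nra.
Qed.

(** The [U]-equation gives [A = - lambda * P / 2] and the [P]-equation gives
    [U ^ 2 = P * (1 + A) / lambda], which match the listed [P] and [U]. *)
Lemma from_critical_point_anisotropic (lambda : R) :
  0 < lambda ->
  from_critical_point lambda
    (1 / (2 * sqrt 3) * ((2 - lambda ^ 2) / (lambda ^ 2 + 1)))
    (sqrt (lambda ^ 2 + 2) / (sqrt 2 * (lambda ^ 2 + 1)))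
    (lambda / (lambda ^ 2 + 1))
    (fun t => 2 * (lambda ^ 2 + 1) / (lambda ^ 2 * t))
    (fun t => (2 - lambda ^ 2) / (sqrt 3 * lambda ^ 2 * t))
    (fun t => 2 / (lambda * t))
    (fun t => 2 * (lambda ^ 2 + 2) / (lambda ^ 4 * t ^ 2)).
Proof.
  intros Hl.
  assert (H3 : sqrt 3 ^ 2 = 3) by (apply pow2_sqrt; lra).
  assert (H0 : sqrt 3 <> 0) by (apply Rgt_not_eq, sqrt_lt_R0; lra).
  assert (Hl1 : lambda ^ 2 + 1 <> 0) by nra.
  assert (H2 : 0 < sqrt 2) by (apply sqrt_lt_R0; lra).
  assert (HU : 0 <= sqrt (lambda ^ 2 + 2) / (sqrt 2 * (lambda ^ 2 + 1))).
  { apply Rcomplements.Rdiv_le_0_compat; [apply sqrt_pos |].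
    apply Rmult_lt_0_compat; nra. }
  assert (HU2 : (sqrt (lambda ^ 2 + 2) / (sqrt 2 * (lambda ^ 2 + 1))) ^ 2
                = (lambda ^ 2 + 2) / (2 * (lambda ^ 2 + 1) ^ 2)).
  { unfold Rdiv; rewrite Rpow_mult_distr, pow_inv, Rpow_mult_distr.
    rewrite !pow2_sqrt by nra; reflexivity. }
  revert HU HU2; generalize (sqrt (lambda ^ 2 + 2) / (sqrt 2 * (lambda ^ 2 + 1))).
  intros U HU HU2.
  set (S := 1 / (2 * sqrt 3) * ((2 - lambda ^ 2) / (lambda ^ 2 + 1))).
  assert (HS2 : S ^ 2 = (2 - lambda ^ 2) ^ 2 / (12 * (lambda ^ 2 + 1) ^ 2)).
  { replace 12 with (4 * sqrt 3 ^ 2) by lra; unfold S; field; auto. }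
  assert (EA : A_coef S U (lambda / (lambda ^ 2 + 1))
               = - (lambda ^ 2 / (2 * (lambda ^ 2 + 1))))
    by (unfold A_coef; rewrite HU2, HS2; field; exact Hl1).
  assert (HA : 0 < lambda ^ 2 / (2 * (lambda ^ 2 + 1)))
    by (apply Rdiv_lt_0_compat; nra).
  unfold from_critical_point; rewrite EA.
  repeat split; try rewrite HU2; try exact HU; try lra;
    try (unfold S; field; repeat split; lra).
  (* Once the squares are rational in [lambda], every term carries exactly one factor [1 / sqrt 3],
     which cancels. *)
  - unfold field_S; replace (S ^ 3) with (S * S ^ 2) by ring.
    rewrite HU2, HS2; unfold S; field; auto.
  - unfold field_U; rewrite HU2, HS2; field; exact Hl1.
  - unfold field_P; rewrite HU2, HS2; field; exact Hl1.
Qed.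

(** For [U = 0] both [field_S] and [field_P] contain the factor [2 * S ^ 2 + P ^ 2 - 2 / 3], with
    cofactors [S + 1 / (2 * sqrt 3)] and [P]. Its zero set is an ellipse of critical points, on
    which [A = - 1]. *)
Lemma from_critical_point_stiff (lambda sigma0 psi0 : R) :
  2 / 3 - 2 * sigma0 ^ 2 - psi0 ^ 2 = 0 ->
  from_critical_point lambda sigma0 0 psi0
    (fun t => 1 / t) (fun t => sigma0 / t) (fun t => psi0 / t) (fun _ => 0).
Proof.
  intros H.
  assert (H0 : sqrt 3 <> 0) by (apply Rgt_not_eq, sqrt_lt_R0; lra).
  assert (EP : psi0 ^ 2 = 2 / 3 - 2 * sigma0 ^ 2) by lra.
  assert (EA : A_coef sigma0 0 psi0 = - 1) by (unfold A_coef; lra).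
  unfold from_critical_point; rewrite EA.
  repeat split; try lra; try (field; lra).
  - unfold field_S; rewrite EP; field; exact H0.
  - unfold field_U; ring.
  - unfold field_P; replace (psi0 ^ 3) with (psi0 * psi0 ^ 2) by ring.
    rewrite EP; field.
Qed.

Theorem mainTheorem3 (lambda : R) (hlambda : 0 < lambda) :
  (forall S U P : R, 0 <= U -> critical_point lambda S U P ->
     let A := A_coef S U P in
     let theta := fun t : R => - (1 / (A * t)) in
     let sigma := fun t : R => - (S / (A * t)) in
     let psi := fun t : R => - (P / (A * t)) in
     let z := fun t : R => - (U / (A * t)) in
     let V := fun t : R => U ^ 2 / (A ^ 2 * t ^ 2) in
     A <> 0 /\
     (forall t : R, 0 < t -> 0 <= z t /\ V t = z t ^ 2) /\
     EKG_solution lambda theta sigma z psi)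
  /\
  (let theta := fun t : R => 2 / t in
   let sigma := fun t : R => - (1 / (sqrt 3 * t)) in
   let psi := fun _ : R => 0 in
   let V := fun _ : R => 0 in
   EKG_solution_V lambda theta sigma psi V /\
   from_critical_point lambda (- (1 / (2 * sqrt 3))) 0 0 theta sigma psi V)
  /\
  (lambda <= sqrt 6 ->
   let theta := fun t : R => 6 / (lambda ^ 2 * t) in
   let sigma := fun _ : R => 0 in
   let psi := fun t : R => 2 / (lambda * t) in
   let V := fun t : R => 2 * (6 - lambda ^ 2) / (lambda ^ 4 * t ^ 2) in
   EKG_solution_V lambda theta sigma psi V /\
   from_critical_point lambda
     0 (sqrt ((6 - lambda ^ 2) / 18)) (lambda / 3) theta sigma psi V)
  /\
  (let theta := fun t : R => 2 * (lambda ^ 2 + 1) / (lambda ^ 2 * t) in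
   let sigma := fun t : R => (2 - lambda ^ 2) / (sqrt 3 * lambda ^ 2 * t) in
   let psi := fun t : R => 2 / (lambda * t) in
   let V := fun t : R => 2 * (lambda ^ 2 + 2) / (lambda ^ 4 * t ^ 2) in
   EKG_solution_V lambda theta sigma psi V /\
   from_critical_point lambda
     (1 / (2 * sqrt 3) * ((2 - lambda ^ 2) / (lambda ^ 2 + 1)))
     (sqrt (lambda ^ 2 + 2) / (sqrt 2 * (lambda ^ 2 + 1)))
     (lambda / (lambda ^ 2 + 1)) theta sigma psi V)
  /\
  (forall sigma0 psi0 : R, 2 / 3 - 2 * sigma0 ^ 2 - psi0 ^ 2 = 0 ->
   let theta := fun t : R => 1 / t in
   let sigma := fun t : R => sigma0 / t in
   let psi := fun t : R => psi0 / t in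
   let V := fun _ : R => 0 in
   EKG_solution_V lambda theta sigma psi V /\
   from_critical_point lambda sigma0 0 psi0 theta sigma psi V).
Proof.
  split.
  { intros S U P HU Hc A theta sigma psi z V.
    assert (HA : A < 0) by exact (A_coef_neg lambda S U P hlambda HU Hc).
    assert (HA0 : A <> 0) by lra.
    split; [exact HA0 | split].
    - intros t Ht; exact (self_similar_potential A U t HA HU Ht).
    - exact (self_similar_solution lambda S U P HA0 Hc). }
  (* For each explicit family it remains only to check the critical point and match the formulas;
     the differential equations follow. *)
  assert (both : forall S U P theta sigma psi V,
            from_critical_point lambda S U P theta sigma psi V ->
            EKG_solution_V lambda theta sigma psi V /\
            from_critical_point lambda S U P theta sigma psi V)
    by (intros; split; [eapply from_critical_point_solution |]; eauto).
  split; [| split; [| split]].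
  - exact (both _ _ _ _ _ _ _ (from_critical_point_shear_only lambda)).
  - intros Hl6.
    exact (both _ _ _ _ _ _ _ (from_critical_point_isotropic lambda hlambda Hl6)).
  - exact (both _ _ _ _ _ _ _ (from_critical_point_anisotropic lambda hlambda)).
  - intros sigma0 psi0 H.
    exact (both _ _ _ _ _ _ _ (from_critical_point_stiff lambda sigma0 psi0 H)).
Qed.
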